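(* Let $B\in\mathbb{R}^{n\times n}$ be a symmetric, positive definite matrix with $\|B\|\le L$, and let $x^0,b\in\mathbb{R}^n$ be given. Suppose that $\{x_R^k\}_k$ is generated by the conjugate residual (CR) method to solve the linear system $B(x-x^0)=b$ with initial point $x_R^0=x^0$. Then, for every $k\ge1$, $$\varphi(\bar x_R^k)\le\varphi(\tilde x_R^{k-1})\qquad\text{and}\qquad \varphi(x_R^k)\le\varphi(\bar x_R^{k-1}),$$ where $\varphi(x)=\frac12(x-x^0)^\top B(x-x^0)-b^\top(x-x^0)$, $\bar x_R^k=x_R^k-\frac1L(B(x_R^k-x^0)-b)$ and $\tilde x_R^k=\bar x_R^k-\frac1L(B(\bar x_R^k-x^0)-b)$.
   Context: $\|B\|$ is the spectral norm. CR iterates: $x_R^k=\mathrm{argmin}_{x\in x^0+\mathcal{K}^k(B,b)}\|B(x-x^0)-b\|^2$, where $\mathcal{K}^k(B,b)=\mathrm{span}\{b,Bb,\dots,B^{k-1}b\}$ and $\mathcal K^0(B,b)=\{0\}$. *)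

(* Defs.v *)
From HB Require Import structures.
From mathcomp Require Import all_boot all_order all_algebra.
From mathcomp Require Import classical_sets reals.

Set Implicit Arguments.
Unset Strict Implicit.
Unset Printing Implicit Defensive.

Import Order.TTheory GRing.Theory Num.Theory.
Local Open Scope classical_set_scope.
Local Open Scope ring_scope.

Definition dotv (R : realType) (n : nat) (u v : 'cV[R]_n) : R :=
  (u^T *m v) 0 0.

(* The Euclidean norm; the norm MathComp-Analysis puts on matrices is the
   max-norm. *)
Definition enorm (R : realType) (n : nat) (u : 'cV[R]_n) : R :=
  Num.sqrt (dotv u u).

Definition spectral_norm (R : realType) (m n : nat) (A : 'M[R]_(m, n)) : R :=
  sup [set enorm (A *m x) | x in [set x : 'cV[R]_n | enorm x <= 1]].

Definition posdefmx (R : realType) (n : nat) (A : 'M[R]_n) : Prop :=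
  forall x : 'cV[R]_n, x != 0 -> 0 < dotv x (A *m x).

Definition is_argmin (R : realType) (T : Type) (f : T -> R) (D : set T) (x : T)
    : Prop :=
  D x /\ forall y : T, D y -> f x <= f y.

Definition krylov (R : realType) (n : nat) (B : 'M[R]_n) (b : 'cV[R]_n)
    (k : nat) : {vspace 'cV[R]_n} :=
  <<[seq B ^+ i *m b | i <- iota 0 k]>>%VS.

Definition CR_iterates (R : realType) (n : nat) (B : 'M[R]_n)
    (x0 b : 'cV[R]_n) (xR : nat -> 'cV[R]_n) : Prop :=
  xR 0%N = x0 /\
  forall k : nat,
    is_argmin (fun x => enorm (B *m (x - x0) - b) ^+ 2)
      [set x | exists2 v, v \in krylov B b k & x = x0 + v] (xR k).

Definition phi (R : realType) (n : nat) (B : 'M[R]_n) (x0 b x : 'cV[R]_n) : R :=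
  2^-1 * dotv (x - x0) (B *m (x - x0)) - dotv b (x - x0).

Definition grad_step (R : realType) (n : nat) (B : 'M[R]_n) (x0 b : 'cV[R]_n)
    (L : R) (x : 'cV[R]_n) : 'cV[R]_n :=
  x - L^-1 *: (B *m (x - x0) - b).

(* Main.v *)
Require Import Defs.
From HB Require Import structures.
From mathcomp Require Import all_boot all_order all_algebra.
From mathcomp Require Import classical_sets reals.
From mathcomp Require Import ring lra.

Set Implicit Arguments.
Unset Strict Implicit.
Unset Printing Implicit Defensive.

Import Order.TTheory GRing.Theory Num.Theory.
Local Open Scope ring_scope.

(** Write [s_k = x_R^k - x0], [r_k = b - B s_k] (minus the gradient of [phi]
    at [x_R^k]), [d_k = s_{k+1} - s_k] and [K_k] for the Krylov spaces.
    Minimality of the residual means [r_k _|_ B K_k] ([argmin_orth]), and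
    everything is deduced from this orthogonality.

    Since [phi] is convex, [phi x <= phi y] follows once the residual at [x] has
    a nonnegative product with [x - y] ([phi_le_residual]).  For the second
    inequality of the theorem this asks for
      [r_{k+1} . d_k >= |r_{k+1}|^2 / L],
    because [r_{k+1} . r_k = |r_{k+1}|^2]: the difference [r_k - r_{k+1} = B d_k]
    lies in [B K_{k+1}].

    The lower bound rests on the short recurrence of the method, which is
    recovered here from the minimisation property alone:
      [d_k = a (r_k + g d_{k-1})] with [a >= 1/L] and [g >= 0]
    ([step_recurrence]).  Indeed [g] can be chosen so that the bracket [w] is
    orthogonal to [K_k] for the inner product [(u, v) |-> Bu . Bv]
    ([conjugate_direction]); as [K_{k+1}] has at most one dimension more than
    [K_k], and [d_k] has the same orthogonality, [d_k] is a multiple of [w]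
    ([krylov_split]).  Moreover [a |Bw|^2 = r_k . B r_k >= |B r_k|^2 / L] by
    [B^2 <= L B], and [|Bw| <= |B r_k|] by Pythagoras, which gives [a >= 1/L].
    Unrolling the recurrence shows that [r_j . d_k >= 0] for [k < j], hence
    [r_{k+1} . d_k >= a |r_{k+1}|^2].

    For the first inequality, the same expansion with [l = 1/L] leaves
      [r . d_k - l |r|^2 - l^2 (r . B r) - l^3 (B r . B r_k)], [r = r_{k+1}],
    and the recurrence also gives [a (B r . B r_k) = - r . B r]
    ([step_length]), so that the last term is positive; it compensates for the
    third one thanks to [B <= L I] ([two_gradient_steps_gain]). *)

(** * The Euclidean inner product *)

Lemma dotvE (R : realType) (n : nat) (u v : 'cV[R]_n) :
  dotv u v = \sum_i u i 0 * v i 0.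
Proof. by rewrite /dotv mxE; apply: eq_bigr => i _; rewrite mxE. Qed.

Lemma dotvC (R : realType) (n : nat) (u v : 'cV[R]_n) : dotv u v = dotv v u.
Proof. by rewrite !dotvE; apply: eq_bigr => i _; rewrite mulrC. Qed.

Lemma dotvDr (R : realType) (n : nat) (u v w : 'cV[R]_n) :
  dotv u (v + w) = dotv u v + dotv u w.
Proof. by rewrite /dotv mulmxDr mxE. Qed.

Lemma dotvDl (R : realType) (n : nat) (u v w : 'cV[R]_n) :
  dotv (u + v) w = dotv u w + dotv v w.
Proof. by rewrite dotvC dotvDr !(dotvC w). Qed.

Lemma dotvZr (R : realType) (n : nat) (c : R) (u v : 'cV[R]_n) :
  dotv u (c *: v) = c * dotv u v.
Proof. by rewrite /dotv -scalemxAr mxE. Qed.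

Lemma dotvZl (R : realType) (n : nat) (c : R) (u v : 'cV[R]_n) :
  dotv (c *: u) v = c * dotv u v.
Proof. by rewrite dotvC dotvZr dotvC. Qed.

Lemma dotvNr (R : realType) (n : nat) (u v : 'cV[R]_n) :
  dotv u (- v) = - dotv u v.
Proof. by rewrite -scaleN1r dotvZr mulN1r. Qed.

Lemma dotvNl (R : realType) (n : nat) (u v : 'cV[R]_n) :
  dotv (- u) v = - dotv u v.
Proof. by rewrite dotvC dotvNr dotvC. Qed.

Lemma dotv0r (R : realType) (n : nat) (u : 'cV[R]_n) : dotv u 0 = 0.
Proof. by rewrite /dotv mulmx0 mxE. Qed.

Lemma dotv0l (R : realType) (n : nat) (u : 'cV[R]_n) : dotv 0 u = 0.
Proof. by rewrite dotvC dotv0r. Qed.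

Definition dotv_lin := (dotvDl, dotvDr, dotvNl, dotvNr, dotvZl, dotvZr).

Lemma dotv_ge0 (R : realType) (n : nat) (u : 'cV[R]_n) : 0 <= dotv u u.
Proof. by rewrite dotvE; apply: sumr_ge0 => i _; rewrite -expr2 sqr_ge0. Qed.

Lemma dotv_eq0 (R : realType) (n : nat) (u : 'cV[R]_n) :
  (dotv u u == 0) = (u == 0).
Proof.
apply/idP/eqP => [|->]; last by rewrite dotv0r.
rewrite dotvE psumr_eq0 => [/allP u0|i _]; last by rewrite -expr2 sqr_ge0.
apply/matrixP => i j; rewrite ord1 mxE.
by have := u0 i (mem_index_enum i); rewrite /= mulf_eq0 orbb => /eqP.
Qed.

Lemma dotv_gt0 (R : realType) (n : nat) (u : 'cV[R]_n) :
  (0 < dotv u u) = (u != 0).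
Proof. by rewrite lt0r dotv_eq0 dotv_ge0 andbT. Qed.

Lemma enorm_sqr (R : realType) (n : nat) (u : 'cV[R]_n) :
  enorm u ^+ 2 = dotv u u.
Proof. by rewrite sqr_sqrtr // dotv_ge0. Qed.

Lemma dotv_mulmxl (R : realType) (m n : nat) (A : 'M[R]_(m, n))
    (u : 'cV[R]_n) (v : 'cV[R]_m) :
  dotv (A *m u) v = dotv u (A^T *m v).
Proof. by rewrite /dotv trmx_mul mulmxA. Qed.

Lemma posdefmx_ge0 (R : realType) (n : nat) (A : 'M[R]_n) (x : 'cV[R]_n) :
  posdefmx A -> 0 <= dotv x (A *m x).
Proof.
by move=> Apos; have [->|/Apos/ltW //] := eqVneq x 0; rewrite dotv0l.
Qed.

(** Minimise the nonnegative quadratic [t |-> (x - t y)^T M (x - t y)]. *)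
Lemma psd_Cauchy_Schwarz (R : realType) (n : nat) (M : 'M[R]_n)
    (x y : 'cV[R]_n) :
  M^T = M -> (forall z, 0 <= dotv z (M *m z)) ->
  dotv x (M *m y) ^+ 2 <= dotv x (M *m x) * dotv y (M *m y).
Proof.
move=> Msym Mpsd.
have yx : dotv y (M *m x) = dotv x (M *m y) by rewrite dotvC dotv_mulmxl Msym.
have Q s t : 0 <= s ^+ 2 * dotv x (M *m x) - 2 * s * t * dotv x (M *m y)
                 + t ^+ 2 * dotv y (M *m y).
  have := Mpsd (s *: x - t *: y).
  by rewrite mulmxBr -!scalemxAr !dotv_lin yx; congr (0 <= _); ring.
set a := dotv x (M *m x) in Q *; set c := dotv y (M *m y) in Q *.
set e := dotv x (M *m y) in Q *.
have [c0|c0] := eqVneq c 0; last first.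
  (* [t = e s / c] is the minimiser; [s = c] avoids the division. *)
  have cp : 0 < c by rewrite lt0r c0 Mpsd.
  rewrite -subr_ge0 -(pmulr_rge0 _ cp).
  by have := Q c e; congr (0 <= _); ring.
have [e0|e0] := eqVneq e 0; first by rewrite e0 c0 mulr0 expr0n.
(* The quadratic degenerates to [a - 2 t e], equal to [-1] at this [t]. *)
have := Q 1 ((a + 1) / (2 * e)); rewrite c0 => {}Q.
have : 2 * 1 * ((a + 1) / (2 * e)) * e = a + 1 by field; rewrite e0.
by lra.
Qed.

Lemma Cauchy_Schwarz (R : realType) (n : nat) (x y : 'cV[R]_n) :
  dotv x y ^+ 2 <= dotv x x * dotv y y.
Proof.
have := @psd_Cauchy_Schwarz _ _ 1%:M x y; rewrite !mul1mx; apply.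
  exact: trmx1.
by move=> z; rewrite mul1mx dotv_ge0.
Qed.

(** * Bounds from the spectral norm *)

(** The supremum defining the spectral norm is taken over a bounded set: the
    Frobenius norm is an upper bound. *)
Lemma enorm_mulmx_has_ubound (R : realType) (m n : nat) (A : 'M[R]_(m, n)) :
  has_ubound [set enorm (A *m x) | x in [set x : 'cV[R]_n | enorm x <= 1]]%classic.
Proof.
exists (Num.sqrt (\sum_i dotv (row i A)^T (row i A)^T)) => _ [x /= x1 <-].
apply: ler_wsqrtr; rewrite dotvE; apply: ler_sum => i _.
have -> : (A *m x) i 0 = dotv (row i A)^T x.
  by rewrite dotvE mxE; apply: eq_bigr => j _; rewrite !mxE.
rewrite -expr2; apply: (le_trans (Cauchy_Schwarz _ _)).
rewrite ler_piMr ?dotv_ge0 // -enorm_sqr expr_le1 //; exact: sqrtr_ge0.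
Qed.

Lemma enorm_mulmx_le (R : realType) (m n : nat) (A : 'M[R]_(m, n))
    (x : 'cV[R]_n) :
  enorm (A *m x) <= spectral_norm A * enorm x.
Proof.
have [->|x0] := eqVneq x 0.
  by rewrite mulmx0 /enorm !dotv0r sqrtr0 mulr0.
have xp : 0 < enorm x by rewrite sqrtr_gt0 dotv_gt0.
have enormZ k (c : R) (u : 'cV[R]_k) : 0 <= c -> enorm (c *: u) = c * enorm u.
  move=> c0; rewrite /enorm dotvZl dotvZr mulrA -expr2 sqrtrM ?sqr_ge0 //.
  by rewrite sqrtr_sqr ger0_norm.
have ip : 0 <= (enorm x)^-1 by rewrite invr_ge0 ltW.
rewrite -ler_pdivrMr // mulrC -enormZ // scalemxAr.
apply: ub_le_sup; first exact: enorm_mulmx_has_ubound.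
by exists ((enorm x)^-1 *: x) => //=; rewrite enormZ // mulVf // gt_eqF.
Qed.

Lemma spectral_norm_sqr_bound (R : realType) (m n : nat) (A : 'M[R]_(m, n))
    (L : R) (x : 'cV[R]_n) :
  spectral_norm A <= L -> dotv (A *m x) (A *m x) <= L ^+ 2 * dotv x x.
Proof.
move=> AL; have xp : 0 <= enorm x by exact: sqrtr_ge0.
have AxL : enorm (A *m x) <= L * enorm x.
  by apply: le_trans (enorm_mulmx_le _ _) _; apply: ler_wpM2r.
have Ax0 : 0 <= enorm (A *m x) by exact: sqrtr_ge0.
by rewrite -!enorm_sqr -exprMn lerXn2r // nnegrE (le_trans Ax0).
Qed.

(** The operator inequality [B <= L I], from Cauchy-Schwarz on [x . Bx]. *)
Lemma psd_quad_le (R : realType) (n : nat) (B : 'M[R]_n) (L : R)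
    (x : 'cV[R]_n) :
  0 <= L -> dotv (B *m x) (B *m x) <= L ^+ 2 * dotv x x ->
  dotv x (B *m x) <= L * dotv x x.
Proof.
move=> L0 BxL; have x0 := dotv_ge0 x.
apply: (le_trans (ler_norm _)); rewrite -ler_sqr ?nnegrE ?mulr_ge0 //.
rewrite real_normK ?num_real //; apply: (le_trans (Cauchy_Schwarz _ _)).
have -> : (L * dotv x x) ^+ 2 = dotv x x * (L ^+ 2 * dotv x x) by ring.
exact: ler_wpM2l.
Qed.

(** The operator inequality [B^2 <= L B].  A proof without square roots or
    diagonalisation: Cauchy-Schwarz for the form of [B] applied to [x] and
    [Bx], followed by [B <= L I] at [Bx]. *)
Lemma psd_sqr_le (R : realType) (n : nat) (B : 'M[R]_n) (L : R)
    (x : 'cV[R]_n) :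
  B^T = B -> (forall z, 0 <= dotv z (B *m z)) -> 0 <= L ->
  (forall z, dotv (B *m z) (B *m z) <= L ^+ 2 * dotv z z) ->
  dotv (B *m x) (B *m x) <= L * dotv x (B *m x).
Proof.
move=> Bsym Bpsd L0 BL; set c := dotv (B *m x) (B *m x).
have [c0|c0] := eqVneq c 0; first by rewrite c0 mulr_ge0.
have cp : 0 < c by rewrite lt0r c0 dotv_ge0.
rewrite -(ler_pM2l cp) -expr2 {1}/c dotv_mulmxl Bsym.
apply: le_trans (psd_Cauchy_Schwarz x (B *m x) Bsym Bpsd) _.
rewrite (_ : c * _ = dotv x (B *m x) * (L * c)); last by ring.
exact/ler_wpM2l/psd_quad_le.
Qed.

(** * Krylov spaces *)

Lemma krylovS (R : realType) (n : nat) (B : 'M[R]_n) (b : 'cV[R]_n) (k : nat) :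
  krylov B b k.+1 = (krylov B b k + <[B ^+ k *m b]>)%VS.
Proof. by rewrite /krylov -(addn1 k) iotaD map_cat span_cat /= span_seq1. Qed.

Lemma krylov0P (R : realType) (n : nat) (B : 'M[R]_n) (b v : 'cV[R]_n) :
  v \in krylov B b 0 -> v = 0.
Proof. by rewrite /krylov span_nil memv0 => /eqP. Qed.

Lemma krylov_sub (R : realType) (n : nat) (B : 'M[R]_n) (b v : 'cV[R]_n)
    (k : nat) : v \in krylov B b k -> v \in krylov B b k.+1.
Proof. by rewrite krylovS; apply/subvP/addvSl. Qed.

Lemma krylov_sub_leq (R : realType) (n : nat) (B : 'M[R]_n) (b v : 'cV[R]_n)
    (j k : nat) : (j <= k)%N -> v \in krylov B b j -> v \in krylov B b k.
Proof.
by move/subnK <-; elim: (k - j)%N => //= m IHm /IHm; apply: krylov_sub.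
Qed.

Lemma krylov_gen (R : realType) (n : nat) (B : 'M[R]_n) (b : 'cV[R]_n)
    (k : nat) : B ^+ k *m b \in krylov B b k.+1.
Proof. by rewrite krylovS; apply/(subvP (addvSr _ _))/memv_line. Qed.

Lemma krylov_mulmx (R : realType) (n : nat) (B : 'M[R]_n) (b v : 'cV[R]_n)
    (k : nat) : v \in krylov B b k -> B *m v \in krylov B b k.+1.
Proof.
elim: k v => [|k IHk] v; first by move/krylov0P ->; rewrite mulmx0 mem0v.
rewrite krylovS => /memv_addP [u uK [_ /vlineP [c ->] ->]].
rewrite mulmxDr -scalemxAr mulmxA.
apply: memvD; first by apply/krylov_sub/IHk.
by apply: memvZ; have := krylov_gen B b k.+1; rewrite exprS.
Qed.

Lemma krylov_base (R : realType) (n : nat) (B : 'M[R]_n) (b : 'cV[R]_n)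
    (k : nat) : b \in krylov B b k.+1.
Proof.
apply: (@krylov_sub_leq _ _ _ _ _ 1) => //.
by have := krylov_gen B b 0; rewrite expr0 mul1mx.
Qed.

(** Each Krylov space adds at most one dimension, so a vector [w] of the
    larger one with [Bw] nonzero and orthogonal to the image of the smaller one
    spans a complement. *)
Lemma krylov_split (R : realType) (n : nat) (B : 'M[R]_n) (b w u : 'cV[R]_n)
    (k : nat) :
  w \in krylov B b k.+1 -> B *m w != 0 ->
  (forall v, v \in krylov B b k -> dotv (B *m w) (B *m v) = 0) ->
  u \in krylov B b k.+1 -> exists c, u - c *: w \in krylov B b k.
Proof.
rewrite krylovS => /memv_addP [v vK [_ /vlineP [c ->] wE]] w0 worth.
move=> /memv_addP [v' v'K [_ /vlineP [c' ->] ->]].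
have [c0|c0] := eqVneq c 0.
  move: w0; rewrite -dotv_eq0 worth ?eqxx //.
  by rewrite wE c0 scale0r addr0.
exists (c' / c); rewrite wE scalerDr scalerA divfK // opprD addrACA subrr addr0.
by apply: memvB => //; apply: memvZ.
Qed.

(** * Residual minimisation over nested Krylov spaces *)

(** First-order optimality of the least-squares problem, by comparing with
    [s + t v] for every scalar [t]. *)
Lemma argmin_orth (R : realType) (n : nat) (B : 'M[R]_n) (b s v : 'cV[R]_n)
    (U : {vspace 'cV[R]_n}) :
  s \in U ->
  (forall u, u \in U -> dotv (b - B *m s) (b - B *m s)
                        <= dotv (b - B *m u) (b - B *m u)) ->
  v \in U -> dotv (b - B *m s) (B *m v) = 0.
Proof.
move=> sU smin vU; set r := b - B *m s in smin *.
have Q t : 0 <= t ^+ 2 * dotv (B *m v) (B *m v) - 2 * t * dotv r (B *m v).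
  have := smin (s + t *: v) (memvD sU (memvZ _ vU)).
  rewrite mulmxDr opprD addrA -/r -scalemxAr; clearbody r.
  rewrite !dotv_lin (dotvC (B *m v) r).
  by rewrite -subr_ge0; congr (0 <= _); ring.
have [c0|c0] := eqVneq (B *m v) 0; first by rewrite c0 dotv0r.
have cp : 0 < dotv (B *m v) (B *m v) by rewrite dotv_gt0.
have := Q (dotv r (B *m v) / dotv (B *m v) (B *m v)).
move: (dotv r _) (dotv (B *m v) _) cp => a c cp.
have -> : (a / c) ^+ 2 * c - 2 * (a / c) * a = - (a ^+ 2 / c).
  by field; rewrite gt_eqF.
rewrite oppr_ge0 pmulr_lle0 ?invr_gt0 // => a2.
by apply/eqP; rewrite -sqrf_eq0 eq_le a2 sqr_ge0.
Qed.

Section ConjugateResidual.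

Variables (R : realType) (n : nat) (B : 'M[R]_n) (L : R) (b : 'cV[R]_n).
(* The residuals and the steps are variables tied to [s] by equations, so that
   expanding inner products by bilinearity leaves them whole. *)
Variables s r d : nat -> 'cV[R]_n.

Hypothesis rE : forall k, r k = b - B *m s k.
Hypothesis dE : forall k, d k = s k.+1 - s k.
Hypothesis Bsym : B^T = B.
Hypothesis Bpos : posdefmx B.
Hypothesis BL : forall z, dotv (B *m z) (B *m z) <= L ^+ 2 * dotv z z.
Hypothesis L_ge0 : 0 <= L.
Hypothesis sK : forall k, s k \in krylov B b k.
Hypothesis r_orth : forall k v, v \in krylov B b k -> dotv (r k) (B *m v) = 0.

Let psd z : 0 <= dotv z (B *m z).
Proof. exact: posdefmx_ge0. Qed.

Let quad_eq0 z : dotv z (B *m z) = 0 -> z = 0.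
Proof. by move=> zBz; apply: contra_eq zBz => /Bpos; rewrite lt0r => /andP[]. Qed.

Let symB u v : dotv (B *m u) v = dotv u (B *m v).
Proof. by rewrite dotv_mulmxl Bsym. Qed.

Lemma residual_krylov k : r k \in krylov B b k.+1.
Proof.
by rewrite rE; apply: memvB; [apply: krylov_base | apply: krylov_mulmx].
Qed.

Lemma step_krylov k : d k \in krylov B b k.+1.
Proof. by rewrite dE; apply: memvB; [|apply: krylov_sub]. Qed.

Lemma residual_step k : B *m d k = r k - r k.+1.
Proof. by rewrite !rE dE mulmxBr opprB [RHS]addrC addrA subrK. Qed.

Lemma step_orth k v : v \in krylov B b k -> dotv (B *m d k) (B *m v) = 0.
Proof.
move=> vK; rewrite residual_step !dotv_lin !r_orth ?subrr //.
exact: krylov_sub.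
Qed.

(** The increments of the residual beyond index [j] lie in [B K_k]. *)
Lemma dotv_residual j k : (j <= k)%N -> dotv (r k) (r j) = dotv (r k) (r k).
Proof.
move=> jk; have -> : r j = r k + B *m (s k - s j).
  by rewrite !rE mulmxBr addrA subrK.
rewrite dotvDr r_orth ?addr0 //.
by apply: memvB => //; apply: krylov_sub_leq jk _.
Qed.

(** Finite termination: once the system is solved it stays solved.  This lets
    the later lemmas assume that the residuals do not vanish. *)
Lemma residual_eq0 j k : (j <= k)%N -> r j = 0 -> r k = 0.
Proof.
by move=> jk rj; apply/eqP; rewrite -dotv_eq0 -(dotv_residual jk) rj dotv0r.
Qed.

Lemma residual_conj j k : (j < k)%N -> dotv (r k) (B *m r j) = 0.
Proof.
by move=> jk; rewrite r_orth //; apply: krylov_sub_leq jk (residual_krylov j).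
Qed.

Definition prev_step k := if k is k'.+1 then d k' else 0.

(** [B r_k] is already orthogonal to [B K_{k-1}], because [B] is symmetric and
    [B K_{k-1}] lies in [K_k]; only the direction [d_{k-1}] has to be corrected.  The Gram-Schmidt
    coefficient is nonnegative because [B r_k . B d_{k-1} = - r_k . B r_k]. *)
Lemma conjugate_direction k : r k != 0 ->
  exists2 g, 0 <= g & forall v, v \in krylov B b k ->
    dotv (B *m (r k + g *: prev_step k)) (B *m v) = 0.
Proof.
case: k => [|k] r0 /=.
  by exists 0 => // v /krylov0P ->; rewrite mulmx0 dotv0r.
have d0 : B *m d k != 0.
  rewrite residual_step subr_eq0; apply: contraNneq r0 => rkE.
  by apply/eqP/quad_eq0; rewrite -{2}rkE residual_conj.
have dp : 0 < dotv (B *m d k) (B *m d k) by rewrite dotv_gt0.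
have rd : dotv (B *m r k.+1) (B *m d k) = - dotv (r k.+1) (B *m r k.+1).
  by rewrite residual_step dotvDr dotvNr !symB (residual_conj (ltnSn k)) sub0r.
exists (dotv (r k.+1) (B *m r k.+1) / dotv (B *m d k) (B *m d k)).
  by rewrite divr_ge0 // ltW.
move=> v vK; have [c v'K] := krylov_split (step_krylov k) d0 (@step_orth k) vK.
have -> : v = (v - c *: d k) + c *: d k by rewrite subrK.
move: (v - c *: d k) v'K => v' v'K.
have rv' : dotv (B *m r k.+1) (B *m v') = 0.
  by rewrite symB r_orth //; apply: krylov_mulmx.
rewrite !mulmxDr -!scalemxAr !dotv_lin rv' rd (step_orth v'K).
by field; rewrite gt_eqF.
Qed.

(** The bound on [a] is that of a minimal residual step along [w]: its exact
    length is [(r_k . B r_k) / |Bw|^2], at least the Rayleigh quotient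
    [(r_k . B r_k) / |B r_k|^2], which is at least [1/L]. *)
Lemma step_recurrence k : r k != 0 ->
  exists a g, [/\ 1 <= L * a, 0 <= g & d k = a *: (r k + g *: prev_step k)].
Proof.
move=> r0; have [g g0 worth] := conjugate_direction r0.
have [w wE] : exists w, w = r k + g *: prev_step k by eexists.
rewrite -wE in worth *.
have pK : prev_step k \in krylov B b k.
  by case: (k) => [|k'] /=; rewrite ?mem0v ?step_krylov.
have rw : dotv (r k) (B *m w) = dotv (r k) (B *m r k).
  by rewrite wE mulmxDr -scalemxAr !dotv_lin (r_orth pK) mulr0 addr0.
have rBr : 0 < dotv (r k) (B *m r k) by apply: Bpos.
have w0 : B *m w != 0 by apply: contraTneq rBr => w0; rewrite -rw w0 dotv0r ltxx.
have wK : w \in krylov B b k.+1.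
  rewrite wE; apply: memvD; first exact: residual_krylov.
  exact/memvZ/krylov_sub.
(* [d_k - a w] is in [K_k] and orthogonal to it, hence zero. *)
have [a daK] := krylov_split wK w0 worth (step_krylov k).
have da : d k = a *: w.
  have : dotv (B *m (d k - a *: w)) (B *m (d k - a *: w)) = 0.
    by rewrite {1}mulmxBr -scalemxAr !dotv_lin step_orth // worth //; ring.
  move/eqP; rewrite dotv_eq0 => /eqP dw; apply/eqP; rewrite -subr_eq0.
  by apply/eqP/quad_eq0; rewrite dw dotv0r.
exists a, g; split=> //; last by rewrite -wE.
have wp : 0 < dotv (B *m w) (B *m w) by rewrite dotv_gt0.
have aw : a * dotv (B *m w) (B *m w) = dotv (r k) (B *m r k).
  rewrite -rw -dotvZl scalemxAr -da residual_step dotvDl dotvNl.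
  by rewrite (r_orth wK) subr0.
(* Pythagoras: [B r_k = Bw - g B d_{k-1}] with orthogonal summands. *)
have ww : dotv (B *m w) (B *m w) <= dotv (B *m r k) (B *m r k).
  have -> : B *m r k = B *m w - g *: (B *m prev_step k).
    by rewrite wE mulmxDr -scalemxAr addrK.
  rewrite !dotv_lin (dotvC (B *m prev_step k) (B *m w)) (worth _ pK).
  have := mulr_ge0 (sqr_ge0 g) (dotv_ge0 (B *m prev_step k)); lra.
rewrite -(ler_pM2r wp) mul1r -mulrA aw.
exact: le_trans ww (psd_sqr_le _ Bsym psd L_ge0 BL).
Qed.

(** Unrolling the recurrence writes [d_k] as a nonnegative combination of
    [r_0, ..., r_k], and [r_j . r_i = |r_j|^2] for [i <= j]. *)
Lemma residual_step_ge0 j k : (k < j)%N -> 0 <= dotv (r j) (d k).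
Proof.
have [rj _|rj] := eqVneq (r j) 0; first by rewrite rj dotv0l.
elim: k => [|k IHk] kj.
all: have /step_recurrence[a [g [La g0 ->]]] : r _ != 0
  := contra_neq (residual_eq0 (ltnW kj)) rj.
all: have a0 : 0 <= a by have := L_ge0; nra.
all: rewrite dotvZr dotvDr dotvZr (dotv_residual (ltnW kj)) /=.
all: rewrite mulr_ge0 // addr_ge0 ?dotv_ge0 // mulr_ge0 //.
  by rewrite dotv0r.
exact/IHk/ltnW.
Qed.

(** The multiplier of the recurrence seen from the next residual.  The last
    equation comes from pairing the recurrence with [B^2 r_{k+1}], which
    annihilates [d_{k-1}] because [B d_{k-1}] lies in [K_{k+1}]. *)
Lemma step_length k : r k.+1 != 0 ->
  exists a, [/\ 1 <= L * a,
    a * dotv (r k.+1) (r k.+1) <= dotv (r k.+1) (d k) &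
    a * dotv (B *m r k.+1) (B *m r k) = - dotv (r k.+1) (B *m r k.+1)].
Proof.
move=> r1; have r0 : r k != 0 := contra_neq (residual_eq0 (leqnSn k)) r1.
have [a [g [La g0 dkE]]] := step_recurrence r0.
have a0 : 0 <= a by have := L_ge0; nra.
exists a; split=> //.
  rewrite dkE dotvZr dotvDr dotvZr (dotv_residual (leqnSn k)) ler_wpM2l //.
  rewrite lerDl mulr_ge0 //; case: (k) => [|k'] /=; first by rewrite dotv0r.
  exact: residual_step_ge0.
have rBp : dotv (B *m r k.+1) (B *m prev_step k) = 0.
  rewrite symB r_orth //; case: (k) => [|k'] /=; first by rewrite mulmx0 mem0v.
  exact/krylov_mulmx/step_krylov.
have -> : - dotv (r k.+1) (B *m r k.+1) = dotv (B *m r k.+1) (B *m d k).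
  by rewrite residual_step dotvDr dotvNr !symB (residual_conj (ltnSn k)) sub0r.
by rewrite dkE -scalemxAr mulmxDr -scalemxAr !dotv_lin rBp mulr0 addr0.
Qed.

Let L_unit k : r k != 0 -> L * L^-1 = 1 /\ 0 < L^-1.
Proof.
move=> r0; have L0 : L != 0.
  apply/eqP => L0; have := psd_quad_le L_ge0 (BL (r k)).
  by rewrite L0 mul0r leNgt Bpos.
by rewrite mulfV // invr_gt0 lt0r L0.
Qed.

(** The step of the method is at least as long as the gradient step:
    [r_{k+1} . d_k >= a |r_{k+1}|^2 >= |r_{k+1}|^2 / L]. *)
Lemma one_gradient_step_gain k :
  0 <= dotv (r k.+1) (s k.+1 - (s k + L^-1 *: r k)).
Proof.
have [->|r1] := eqVneq (r k.+1) 0; first by rewrite dotv0l.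
have [Ll lp] := L_unit r1; have [a [La rd _]] := step_length r1.
rewrite opprD addrA -dE !dotv_lin (dotv_residual (leqnSn k)).
have la : L^-1 <= a by nra.
by have := dotv_ge0 (r k.+1); nra.
Qed.

(** A gradient step multiplies the residual by [I - l B], which makes [rbar] the
    residual after one such step. *)
Lemma two_gradient_steps_gain k (l := L^-1)
    (rbar := fun k => r k - l *: (B *m r k)) :
  0 <= dotv (rbar k.+1)
         (s k.+1 + l *: r k.+1 - (s k + l *: r k + l *: rbar k)).
Proof.
rewrite /rbar; have [->|r1] := eqVneq (r k.+1) 0.
  by rewrite mulmx0 scaler0 subr0 dotv0l.
have [Ll lp] := L_unit r1; have [a [La rd rBBr]] := step_length r1.
have -> : s k.+1 + l *: r k.+1 - (s k + l *: r k + l *: (r k - l *: (B *m r k)))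
    = d k + l *: r k.+1 - (l *: r k + l *: (r k - l *: (B *m r k))).
  by rewrite dE -(addrA (s k)) opprD addrACA addrA.
have rr := dotv_residual (leqnSn k).
have rBq := residual_conj (ltnSn k).
have rBd := r_orth (step_krylov k).
rewrite !dotv_lin !symB rr rBq rBd -(symB (r k.+1) (B *m r k)).
have rBr := psd (r k.+1).
have rBrL := psd_quad_le L_ge0 (BL (r k.+1)).
have rr0 := dotv_ge0 (r k.+1).
have ap : 0 < a by have := L_ge0; nra.
rewrite -/l in Ll lp.
have la : l <= a by nra.
have lrBr : l * dotv (r k.+1) (B *m r k.+1) <= dotv (r k.+1) (r k.+1).
  by have := ler_wpM2l (ltW lp) rBrL; rewrite mulrA (mulrC l L) Ll mul1r.
move: rd rBBr rBr lrBr rr0 {rr rBq rBd rBrL}.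
move: (dotv _ (d k)) => X; move: (dotv _ (r k.+1)) => rho.
move: (dotv _ (B *m r k.+1)) => e; move: (dotv _ _) => z rd rBBr rBr lrBr rr0.
(* After multiplication by [a] the unknown [a z] can be replaced by [- e]; what
   remains has the factor [a - l], and the other factor is
   [a rho - l^2 e = l (rho - l e) + (a - l) rho]. *)
rewrite -(pmulr_rge0 _ ap) (_ : a * _ = a * (X - a * rho)
  + (a - l) * (l * (rho - l * e) + (a - l) * rho)
  + l ^+ 3 * (- e - a * z)); last by ring.
rewrite rBBr subrr mulr0 addr0.
rewrite -(subr_ge0 l) in la; have [ap' lp'] := (ltW ap, ltW lp).
apply: addr_ge0; first by rewrite mulr_ge0 ?subr_ge0.
by rewrite mulr_ge0 // addr_ge0 // mulr_ge0 // subr_ge0.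
Qed.

End ConjugateResidual.

(** * The energy functional *)

(** The residual [b - B (x - x0)] is minus the gradient of the convex function
    [phi] at [x], so [phi] lies above its tangent plane there. *)
Lemma phi_le_residual (R : realType) (n : nat) (B : 'M[R]_n)
    (x0 b x y : 'cV[R]_n) :
  B^T = B -> (forall z, 0 <= dotv z (B *m z)) ->
  0 <= dotv (b - B *m (x - x0)) ((x - x0) - (y - x0)) ->
  phi B x0 b x <= phi B x0 b y.
Proof.
move=> Bsym Bpsd; rewrite /phi.
have -> : y - x0 = (x - x0) - ((x - x0) - (y - x0)) by rewrite subKr.
move: (x - x0) => u; move: (u - (y - x0)) => h; have := Bpsd h.
have uBh : dotv u (B *m h) = dotv (B *m u) h by rewrite dotv_mulmxl Bsym.
by rewrite !mulmxBr !dotv_lin uBh (dotvC h (B *m u)); lra.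
Qed.

Lemma grad_stepB (R : realType) (n : nat) (B : 'M[R]_n) (x0 b : 'cV[R]_n)
    (L : R) (x : 'cV[R]_n) :
  grad_step B x0 b L x - x0 = (x - x0) + L^-1 *: (b - B *m (x - x0)).
Proof. by rewrite /grad_step -[b - _]opprB scalerN addrAC. Qed.

Lemma CR_krylov (R : realType) (n : nat) (B : 'M[R]_n) (x0 b : 'cV[R]_n)
    (xR : nat -> 'cV[R]_n) (k : nat) :
  CR_iterates B x0 b xR -> xR k - x0 \in krylov B b k.
Proof. by case=> _ /(_ k) [[v vK ->] _]; rewrite addrC addKr. Qed.

Lemma CR_residual_orth (R : realType) (n : nat) (B : 'M[R]_n)
    (x0 b v : 'cV[R]_n) (xR : nat -> 'cV[R]_n) (k : nat) :
  CR_iterates B x0 b xR -> v \in krylov B b k ->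
  dotv (b - B *m (xR k - x0)) (B *m v) = 0.
Proof.
move=> CR; apply: argmin_orth (CR_krylov k CR) _ => u uK.
have enormB (z : 'cV[R]_n) : enorm (z - b) ^+ 2 = dotv (b - z) (b - z).
  by rewrite enorm_sqr -opprB dotvNl dotvNr opprK.
have [_ /(_ k) [_ /(_ (x0 + u))]] := CR.
rewrite !enormB => /(_ (ex_intro2 _ _ u uK erefl)).
by rewrite [x0 + u - x0]addrAC subrr add0r.
Qed.

Unset Implicit Arguments.

Theorem corollary3p16 (R : realType) (n : nat) (B : 'M[R]_n) (L : R)
    (x0 b : 'cV[R]_n) (xR : nat -> 'cV[R]_n)
    (Bsym : B^T = B) (Bpos : posdefmx B) (BL : spectral_norm B <= L)
    (xR_CR : CR_iterates B x0 b xR) :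
  let xbar := fun k : nat => grad_step B x0 b L (xR k) in
  let xtilde := fun k : nat => grad_step B x0 b L (xbar k) in
  forall k : nat, (1 <= k)%N ->
    phi B x0 b (xbar k) <= phi B x0 b (xtilde k.-1) /\
    phi B x0 b (xR k) <= phi B x0 b (xbar k.-1).
Proof.
move=> xbar xtilde [//|k] _ /=.
have Bpsd z := posdefmx_ge0 z Bpos.
have L_ge0 : 0 <= L.
  apply: le_trans BL; apply: (ub_le_sup (enorm_mulmx_has_ubound B)).
  by exists 0; rewrite /= ?mulmx0 /enorm dotv0r sqrtr0.
have BLz z := spectral_norm_sqr_bound z BL.
pose s k := xR k - x0; pose r k := b - B *m s k.
have sK k' : s k' \in krylov B b k' by apply: CR_krylov xR_CR.
have r_orth k' v : v \in krylov B b k' -> dotv (r k') (B *m v) = 0.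
  exact: CR_residual_orth.
have rE k' : r k' = b - B *m s k' by [].
have dE k' : s k'.+1 - s k' = s k'.+1 - s k' by [].
split; apply: phi_le_residual => //.
  have resbar k' : b - B *m (xbar k' - x0) = r k' - L^-1 *: (B *m r k').
    by rewrite grad_stepB -/(s k') -/(r k') mulmxDr -scalemxAr opprD addrA.
  rewrite [xtilde _ - _]grad_stepB !resbar !grad_stepB.
  exact: (two_gradient_steps_gain rE dE).
rewrite grad_stepB.
exact: (one_gradient_step_gain rE dE).
Qed.
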